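(* Let $\alpha=[a_0;a_1,a_2,\dots]$ be an irrational number that is not of golden type, and let $T_\alpha:X_\alpha\to X_\alpha$ be the cutting-and-stacking transformation described in the context. Then $T_\alpha$ is an infinite measure-preserving transformation (i.e. $X_\alpha$ has infinite Lebesgue measure) if and only if $$\sum_{k=2}^\infty \frac{1}{a_ka_{k-1}}=\infty .$$
   Context: For an irrational $\alpha=[a_0;a_1,a_2,\dots]$ put $q_0=0,\ q_1=1$ and $q_k=a_{k-1}q_{k-1}+q_{k-2}$ for $k\ge 2$. $\alpha$ is of golden type if there is $n$ with $a_k=1$ for all $k\ge n$. Construction of $T_\alpha$ ($\alpha$ irrational, not of golden type). All intervals are left-open and right-closed. The column $C_1$ consists of one level, the unit interval. Suppose the column $C_k$, consisting of $q_k$ disjoint intervals of equal length (levels) $C_k(0),\dots,C_k(q_k-1)$, has been constructed. Cut each level $C_k(n)$ into $a_k$ subintervals of equal length, from left to right $C_k^0(n),\dots,C_k^{a_k-1}(n)$, so that $C_k$ is cut into $a_k$ sub-columns. Stack these from left (bottom) to right (top) and add on top $q_{k-1}$ new disjoint intervals (spacers) of the same length taken from $\mathbb{R}\setminus C_k$. Thus $C_{k+1}$ has $q_{k+1}=a_kq_k+q_{k-1}$ levels, with $C_{k+1}(jq_k+n)=C_k^j(n)$ for $0\le j<a_k$, $0\le n<q_k$, and with $C_{k+1}(a_kq_k+i)$, $0\le i<q_{k-1}$, the spacers. We also write $C_k$ for the union of its levels. Let $X_\alpha=\bigcup_k C_k$, with Lebesgue measure $m$, and let $T_\alpha:X_\alpha\to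 X_\alpha$ map each non-top level $C_k(i)$, $0\le i<q_k-1$, by translation onto $C_k(i+1)$, for all $k$. *)

(* Defs.v *)
From mathcomp Require Import all_boot all_order all_algebra.
From mathcomp Require Import all_classical all_reals all_analysis.
From mathcomp Require Import lra zify.

Set Implicit Arguments.
Unset Strict Implicit.
Unset Printing Implicit Defensive.

Import Order.TTheory GRing.Theory Num.Theory.

Local Open Scope classical_set_scope.
Local Open Scope ring_scope.

(* Complete quotients x_0 = alpha, x_{k+1} = 1 / (x_k - floor x_k), so that
   alpha = [floor x_0; floor x_1, floor x_2, ...] for alpha irrational. *)
Fixpoint complete_quotient (R : realType) (alpha : R) (k : nat) : R :=
  if k is k'.+1 then
    let x := complete_quotient alpha k' in (x - (Num.floor x)%:~R)^-1
  else alpha.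

Definition partial_quotient (R : realType) (alpha : R) (k : nat) : int :=
  Num.floor (complete_quotient alpha k).

Definition golden_type (R : realType) (alpha : R) : Prop :=
  exists n : nat, forall k : nat, (n <= k)%N -> partial_quotient alpha k = 1.

(* The natural number a_k, for k >= 1.  The value at k = 0 is |a_0|, which is
   not used: only a_1, a_2, ... enter the construction and the series. *)
Definition pq (R : realType) (alpha : R) (k : nat) : nat :=
  `|partial_quotient alpha k|%N.

Fixpoint height (a : nat -> nat) (k : nat) : nat :=
  match k with
  | 0 => 0
  | 1 => 1
  | (k'.+1 as k1).+1 => (a k1 * height a k1 + height a k')%N
  end.

(* A tower is given by the left endpoints l k i of the levels C_k(i),
   1 <= k, i < height a k; the other values of l are irrelevant.  Each level
   of C_k has length 1 / (a_1 ... a_{k-1}). *)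
Section Tower.
Variables (R : realType) (a : nat -> nat) (l : nat -> nat -> R).

Definition width (k : nat) : R := \prod_(1 <= i < k) (a i)%:R^-1.

Definition level (k i : nat) : set R := `]l k i, l k i + width k]%classic.

Definition column (k : nat) : set R :=
  \bigcup_(i in [set i | (i < height a k)%N]) level k i.

Definition tower_space : set R := \bigcup_(k in [set k | (0 < k)%N]) column k.

Record is_tower : Prop := IsTower {
  tower_base : l 1%N 0%N = 0;
  tower_cut : forall k j n : nat,
    (0 < k)%N -> (j < a k)%N -> (n < height a k)%N ->
    l k.+1 (j * height a k + n)%N = l k n + j%:R * width k.+1;
  tower_spacer : forall k i : nat, (0 < k)%N -> (i < height a k.-1)%N ->
    level k.+1 (a k * height a k + i)%N `&` column k = set0;
  tower_spacer_disjoint : forall k i j : nat, (0 < k)%N ->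
    (i < height a k.-1)%N -> (j < height a k.-1)%N -> i <> j ->
    level k.+1 (a k * height a k + i)%N `&`
    level k.+1 (a k * height a k + j)%N = set0 }.

(* Only the values of T on tower_space matter. *)
Definition is_tower_map (T : R -> R) : Prop :=
  forall (k i : nat) (x : R), (0 < k)%N -> (i.+1 < height a k)%N ->
    level k i x -> T x = x + (l k i.+1 - l k i).

End Tower.

(* Towers and their maps exist whenever a_k >= 1 for k >= 1: the spacers can be
   placed one after the other to the right of the previous column. *)
Section TowerExistence.
Variables (R : realType) (a : nat -> nat).
Hypothesis a_gt0 : forall k, (0 < k)%N -> (0 < a k)%N.

Let w := @width R a.

Lemma heightSS k : (0 < k)%N ->
  height a k.+1 = (a k * height a k + height a k.-1)%N.
Proof. by case: k. Qed.

Lemma height_gt0 k : (0 < k)%N -> (0 < height a k)%N.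
Proof.
elim: k => // -[//|k] IH _.
by rewrite heightSS // addn_gt0 muln_gt0 a_gt0 // IH.
Qed.

Lemma widthS k : (0 < k)%N -> w k = (a k)%:R * w k.+1.
Proof.
move=> k0; rewrite /w /width big_nat_recr //= mulrC divfK //.
by rewrite pnatr_eq0 -lt0n a_gt0.
Qed.

Lemma width_gt0 k : 0 < w k.
Proof.
rewrite /w /width big_nat; apply: prodr_gt0 => i /andP[i0 _].
by rewrite invr_gt0 ltr0n a_gt0.
Qed.

Fixpoint std_tower (k i : nat) : R :=
  if k is k'.+1 then
    if k' is 0 then 0 else
    let h := height a k' in
    if (i < a k' * h)%N then std_tower k' (i %% h)%N + (i %/ h)%:R * w k
    else h%:R * w k' + (i - a k' * h)%:R * w k
  else 0.

Lemma std_towerSS k i : (0 < k)%N ->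
  std_tower k.+1 i =
  if (i < a k * height a k)%N
  then std_tower k (i %% height a k)%N + (i %/ height a k)%:R * w k.+1
  else (height a k)%:R * w k + (i - a k * height a k)%:R * w k.+1.
Proof. by case: k. Qed.

Local Arguments std_tower : simpl never.

Lemma std_tower_bound k i : (0 < k)%N -> (i < height a k)%N ->
  std_tower k i + w k <= (height a k)%:R * w k.
Proof.
elim: k i => // -[_ [|//] _ _|k IH i _ ih]; first by rewrite add0r mul1r.
have h0 := @height_gt0 k.+1 isT; have W0 := width_gt0 k.+2.
have Hw : (height a k.+2)%:R * w k.+2 =
  (height a k.+1)%:R * w k.+1 + (height a k)%:R * w k.+2.
  by rewrite heightSS // natrD natrM mulrDl [w k.+1]widthS // mulrCA -mulrA.
rewrite Hw std_towerSS //; case: ltnP => [ilt|ige].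
  have /(IH _ isT) B : (i %% height a k.+1 < height a k.+1)%N.
    by rewrite ltn_mod.
  have D : (i %/ height a k.+1).+1%:R * w k.+2 <= w k.+1.
    by rewrite [w k.+1]widthS // ler_wpM2r ?(ltW W0) // ler_nat ltn_divLR.
  have P : 0 <= (height a k)%:R * w k.+2 by rewrite mulr_ge0 ?ler0n // ltW.
  move: D; rewrite -natr1 mulrDl mul1r => D; lra.
rewrite -addrA lerD2l -[X in _ + X]mul1r -mulrDl natr1 ler_wpM2r ?(ltW W0) //.
move: ih ige; rewrite ler_nat heightSS // [k.+1.-1]/=.
move: (a k.+1 * _)%N (height a k) => u v; lia.
Qed.

Lemma std_towerP : is_tower a std_tower.
Proof.
split=> //.
- move=> k j n k0 ja nh; rewrite std_towerSS // ifT; last first.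
    have := leq_mul2r (height a k) j.+1 (a k); rewrite ja orbT mulSn; lia.
  by rewrite modnMDl modn_small // divnMDl ?height_gt0 // divn_small // addn0.
- move=> k i k0 ih; apply/seteqP; split=> // x [] /=.
  rewrite /level /= !in_itv /= std_towerSS // ifN -?leqNgt ?leq_addr //.
  move=> /andP[x1 _] [n /= nh]; rewrite /level /= in_itv /= => /andP[_ x2].
  have B := std_tower_bound k0 nh; rewrite -!/(w _) in x1 x2.
  have P : 0 <= (a k * height a k + i - a k * height a k)%:R * w k.+1.
    by rewrite mulr_ge0 ?ler0n // ltW // width_gt0.
  lra.
- move=> k i j k0.
  wlog ij : i j / (i < j)%N => [H ih jh /eqP|ih jh _].
    rewrite neq_ltn => /orP[] ij; first by apply: H => //; lia.
    by rewrite setIC; apply: H => //; lia.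
  apply/seteqP; split=> // x [] /=; rewrite /level /= !in_itv /=.
  rewrite !std_towerSS // !ifN -?leqNgt ?leq_addr // !addKn.
  move=> /andP[_ x1] /andP[x2 _]; rewrite -!/(w _) in x1 x2.
  have : i.+1%:R * w k.+1 <= j%:R * w k.+1.
    by rewrite ler_wpM2r ?ler_nat // ltW // width_gt0.
  rewrite -natr1 mulrDl mul1r; lra.
Qed.

Variable l : nat -> nat -> R.
Hypothesis l_tower : is_tower a l.

(* Every level of C_{k+1} is either a piece of a level of C_k or a spacer. *)
Lemma level_succ_cases k i : (0 < k)%N -> (i < height a k.+1)%N ->
  (exists j n, [/\ i = (j * height a k + n)%N, (j < a k)%N &
                 (n < height a k)%N]) \/
  (exists2 s, i = (a k * height a k + s)%N & (s < height a k.-1)%N).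
Proof.
move=> k0; rewrite heightSS // => ih; have h0 := height_gt0 k0.
case: (ltnP i (a k * height a k)) => ia; [left|right].
  exists (i %/ height a k)%N, (i %% height a k)%N.
  by rewrite -divn_eq ltn_mod ltn_divLR.
by exists (i - a k * height a k)%N; lia.
Qed.

Lemma level_cut_sub k j n : (0 < k)%N -> (j < a k)%N -> (n < height a k)%N ->
  level a l k.+1 (j * height a k + n)%N `<=` level a l k n.
Proof.
move=> k0 ja nh x; rewrite /level /= !in_itv /= (tower_cut l_tower) //.
rewrite -!/(w _) => /andP[x1 x2]; have W0 := width_gt0 k.+1.
have P : 0 <= j%:R * w k.+1 by rewrite mulr_ge0 ?ler0n // ltW.
have D : j.+1%:R * w k.+1 <= w k.
  by rewrite [w k]widthS // ler_wpM2r ?(ltW W0) // ler_nat.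
move: D; rewrite -natr1 mulrDl mul1r => D; apply/andP; split; lra.
Qed.

Lemma level_inj k i j x : (0 < k)%N -> (i < height a k)%N ->
  (j < height a k)%N -> level a l k i x -> level a l k j x -> i = j.
Proof.
elim: k i j => // -[_ [|i] [|j] //|k IH i j _ ih jh xi xj].
have W0 := width_gt0 k.+2.
case: (@level_succ_cases k.+1 i isT ih) => [[i1 [i2 [Ei ia in_]]]|[s Ei sh]];
case: (@level_succ_cases k.+1 j isT jh) => [[j1 [j2 [Ej ja jn]]]|[t Ej th]];
  subst i j.
- have xi' := @level_cut_sub k.+1 _ _ isT ia in_ _ xi.
  have xj' := @level_cut_sub k.+1 _ _ isT ja jn _ xj.
  have E := IH _ _ isT in_ jn xi' xj'; subst j2; congr (_ * _ + _)%N.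
  move: xi xj; rewrite /level /= !in_itv /= !(tower_cut l_tower) //.
  rewrite -!/(w _) => /andP[p1 p2] /andP[p3 p4].
  apply/eqP; rewrite eqn_leq; apply/andP; split.
    rewrite -ltnS -(ltr_nat R) -(ltr_pM2r W0) -natr1 mulrDl mul1r; lra.
  rewrite -ltnS -(ltr_nat R) -(ltr_pM2r W0) -natr1 mulrDl mul1r; lra.
- have xi' := @level_cut_sub k.+1 _ _ isT ia in_ _ xi.
  have : (level a l k.+2 (a k.+1 * height a k.+1 + t)%N `&`
          column a l k.+1) x by split=> //; exists i2.
  by rewrite (tower_spacer l_tower).
- have xj' := @level_cut_sub k.+1 _ _ isT ja jn _ xj.
  have : (level a l k.+2 (a k.+1 * height a k.+1 + s)%N `&`
          column a l k.+1) x by split=> //; exists j2.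
  by rewrite (tower_spacer l_tower).
- congr (_ + _)%N; apply: contrapT => st.
  have : (level a l k.+2 (a k.+1 * height a k.+1 + s)%N `&`
          level a l k.+2 (a k.+1 * height a k.+1 + t)%N) x by split.
  by rewrite (tower_spacer_disjoint l_tower).
Qed.

Lemma level_cut_cover k i x : (0 < k)%N -> (i < height a k)%N ->
  level a l k i x ->
  exists2 j, (j < a k)%N & level a l k.+1 (j * height a k + i)%N x.
Proof.
move=> k0 ih; rewrite /level /= in_itv /= -!/(w _) => /andP[x1 x2].
have W0 := width_gt0 k.+1; have ak0 := a_gt0 k0.
pose P j := (x - l k i <= j.+1%:R * w k.+1).
have exP : exists j, P j.
  exists (a k).-1; rewrite /P prednK // -widthS //; lra.
case: (ex_minnP exP) => j Pj minj.
have ja : (j < a k)%N.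
  rewrite -(prednK ak0) ltnS; apply: minj.
  by rewrite /P prednK // -widthS //; lra.
exists j => //; rewrite in_itv /= (tower_cut l_tower) // -!/(w _).
have lo : j%:R * w k.+1 < x - l k i.
  case: j Pj minj {ja} => [_ _|j _ minj]; first by rewrite mul0r; lra.
  by rewrite ltNge; apply/negP => /minj; rewrite ltnn.
move: Pj; rewrite /P -natr1 mulrDl mul1r => Pj.
by apply/andP; split; lra.
Qed.

(* Refining C_k to C_{k+d} does not change the translation on non-top levels. *)
Lemma translation_compat d k i x : (0 < k)%N -> (i.+1 < height a k)%N ->
  level a l k i x ->
  exists i', [/\ (i'.+1 < height a (d + k))%N, level a l (d + k) i' x &
    l (d + k)%N i'.+1 - l (d + k)%N i' = l k i.+1 - l k i].
Proof.
move=> k0 ih xi; elim: d => [|d [i' [ih' xi' <-]]]; first by exists i.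
rewrite addSn; have m0 : (0 < d + k)%N by lia.
move: (d + k)%N m0 ih' xi' => m m0 ih' xi'.
have [j ja xj] := level_cut_cover m0 (ltnW ih') xi'.
exists (j * height a m + i')%N; split=> //.
  rewrite heightSS //; have := leq_mul2r (height a m) j.+1 (a m).
  rewrite ja orbT mulSn; lia.
rewrite -addnS !(tower_cut l_tower) //; last exact: ltnW.
by rewrite opprD addrACA subrr addr0.
Qed.

Lemma tower_map_exists : exists T : R -> R, is_tower_map a l T.
Proof.
suff /choice[T HT] : forall x, exists y, forall k i, (0 < k)%N ->
    (i.+1 < height a k)%N -> level a l k i x -> y = x + (l k i.+1 - l k i).
  by exists T => k i x k0 ih xi; exact: HT.
move=> x; have [[k [i [k0 ih xi]]]|no] := pselect (exists k i,
    [/\ (0 < k)%N, (i.+1 < height a k)%N & level a l k i x]); last first.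
  by exists 0 => k i k0 ih xi; case: no; exists k, i.
exists (x + (l k i.+1 - l k i)) => k' i' k0' ih' xi'; congr (_ + _).
have [u [uh xu <-]] := translation_compat k' k0 ih xi.
have [v [vh xv <-]] := translation_compat k k0' ih' xi'.
rewrite (addnC k k') in vh xv *.
by rewrite (level_inj _ (ltnW uh) (ltnW vh) xu xv) //; lia.
Qed.

End TowerExistence.

Lemma pq_gt0 (R : realType) (alpha : R) (k : nat) :
  irrational alpha -> (0 < k)%N -> (0 < pq alpha k)%N.
Proof.
move=> irr.
have Q j : irrational (complete_quotient alpha j).
  elim: j => //= j IH [q _ qE]; apply: IH.
  exists (q^-1 + (partial_quotient alpha j)%:~R) => //.
  rewrite rmorphD /= fmorphV ratr_int -[RHS](subrK (partial_quotient alpha j)%:~R).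
  by congr (_ + _); apply: invr_inj; rewrite invrK; exact: qE.
case: k => // k _; have := Q k; rewrite /pq /partial_quotient /= => irrk.
set x := complete_quotient alpha k in irrk *.
have x1 : 0 < x - (Num.floor x)%:~R.
  rewrite lt_neqAle subr_ge0 floor_le andbT eq_sym subr_eq0.
  apply/eqP => E; apply: irrk; exists (Num.floor x)%:~R => //.
  by rewrite ratr_int.
have x2 : x - (Num.floor x)%:~R < 1.
  by have := floorD1_gt x; rewrite intrD; lra.
have : 1 <= Num.floor (x - (Num.floor x)%:~R)^-1.
  by rewrite floor_ge_int invf_ge1 ?ltW.
lia.
Qed.

Definition measure_preserving_on (R : realType) (X : set R) (T : R -> R) :
    Prop :=
  [/\ measurable X, (forall x, X x -> X (T x)), measurable_fun X T &
      forall A : set R, measurable A -> A `<=` X ->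
        lebesgue_measure (X `&` T @^-1` A) = lebesgue_measure A].

(* Main.v *)
Require Import Defs.
From mathcomp Require Import all_boot all_order all_algebra.
From mathcomp Require Import all_classical all_reals all_analysis.
From mathcomp Require Import measurable_realfun ring lra zify.

(** Write q_k for the height of the column C_k, w_k for the width of its levels
and m_k = q_k w_k for its measure.  The columns increase to the whole space, so
the measure of the space is the limit of m_k.

Going from C_k to C_{k+1} adds q_{k-1} spacers of width
w_{k+1} = w_{k-1} / (a_k a_{k-1}), hence (column_measureS)
  m_{k+1} = m_k + m_{k-1} / (a_k a_{k-1}),   k >= 2.
As 1 <= m_{k-1} <= m_k, each step adds at least 1 / (a_k a_{k-1}) and multiplies
by at most 1 + 1 / (a_k a_{k-1}) <= exp (1 / (a_k a_{k-1})).  With S_k the sum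
of 1 / (a_i a_{i-1}) over 2 <= i < k, this gives 1 + S_k <= m_k <= exp S_k for
k >= 2 (column_measure_ge, column_measure_le), and m_k is unbounded exactly when
the series diverges (tower_space_measure_infinite_iff).

That T preserves the measure is seen on one column at a time: T carries the
union of the non-top levels of C_k onto the union of its non-bottom levels,
moving each level by a translation, so the part of the preimage of A in the
former has the measure of the part of A in the latter
(measure_preimage_nontop).  Both unions increase with k, and each exhausts the
space (tower_space_nontop, tower_space_nonbottom): for the first because every
top level eventually receives spacers above it, for the second because the
bottom level of C_k is the interval from 0 to w_k, and w_k tends to 0.  This
last fact is where golden type is excluded: infinitely many a_k are at least 2,
and each of them at least halves the width.  Continuity from below of the
measure concludes (tower_map_measure_preserving). *)

Import Order.TTheory GRing.Theory Num.Theory.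

Local Open Scope classical_set_scope.
Local Open Scope ring_scope.

Set Implicit Arguments.
Unset Strict Implicit.
Unset Printing Implicit Defensive.

(** * Two facts about measures *)

(** Both sides are measures in A, so it is enough to compare them on half-open
    intervals. *)
Lemma lebesgue_measure_translate (R : realType) (c : R) (A : set R) :
  measurable A ->
  lebesgue_measure ((fun x => x + c) @^-1` A) = lebesgue_measure A.
Proof.
move=> mA.
rewrite -[LHS]/(pushforward (@lebesgue_measure R)
  ((fun x : R => x + c) : _ -> measurableTypeR R) A).
apply/esym/lebesgue_measure_unique => //= [|_ _ [[u v]] _ <-].
  exact: measurable_funD.
rewrite /pushforward.
have -> : (fun x : R => x + c) @^-1` `]u, v]%classic
    = `]u - c, v - c]%classic.
  by apply/seteqP; split=> x /=; rewrite !in_itv /= ltrBlDr lerBrDr.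
rewrite !lebesgue_measure_itv /= !lte_fin ltrD2r; case: ifP => // _.
by rewrite -!EFinD opprB addrA subrK.
Qed.

Lemma measure_tiling d (T : measurableType d) (R : realFieldType)
    (mu : {measure set T -> \bar R}) (F : nat -> set T) (n : nat) (B : set T) :
  (forall i, (i < n)%N -> measurable (B `&` F i)) -> trivIset `I_n F ->
  mu (B `&` \bigcup_(i in `I_n) F i) = (\sum_(i < n) mu (B `&` F i))%E.
Proof.
move=> mF tF; rewrite setI_bigcupr bigcup_mkord.
apply: (measure_semi_additive_ord_I mu (F := fun i => B `&` F i) mF).
- exact: trivIset_setIl.
- by apply: bigsetU_measurable => i _; exact: mF.
Qed.

(** * Columns *)

Local Arguments height : simpl never.

Section Towers.
Variables (R : realType) (a : nat -> nat) (l : nat -> nat -> R).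
Hypothesis a_gt0 : forall k, (0 < k)%N -> (0 < a k)%N.
Hypothesis l_tower : is_tower a l.

Local Notation w := (width R a).
Local Notation mu := (@lebesgue_measure R).

(** A piece of a level of C_k has all q_{k-1} spacers of C_{k+1} above it. *)
Lemma cut_height k j i : (0 < k)%N -> (j < a k)%N -> (i < height a k)%N ->
  (j * height a k + i + height a k.-1 < height a k.+1)%N.
Proof.
move=> k0 ja ih; rewrite heightSS //.
have := leq_mul2r (height a k) j.+1 (a k); rewrite ja orbT mulSn; lia.
Qed.

Lemma measurable_level k i : measurable (level a l k i).
Proof. exact: measurable_itv. Qed.

Lemma trivIset_level k : (0 < k)%N -> trivIset `I_(height a k) (level a l k).
Proof.
move=> k0 i j ih jh [x [xi xj]].
exact: (level_inj a_gt0 l_tower k0 ih jh xi xj).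
Qed.

Lemma lebesgue_measure_level k i : mu (level a l k i) = (w k)%:E.
Proof.
rewrite /level lebesgue_measure_itv /= lte_fin ltrDl (width_gt0 R a_gt0).
by rewrite -EFinD addrAC subrr add0r.
Qed.

Lemma lebesgue_measure_column k : (0 < k)%N ->
  mu (column a l k) = ((height a k)%:R * w k)%:E.
Proof.
move=> k0; rewrite -[column a l k]setTI measure_tiling.
- rewrite (eq_bigr (fun=> (w k)%:E)).
    by rewrite sumEFin sumr_const card_ord mulr_natl.
  by move=> i _; rewrite setTI; exact: lebesgue_measure_level.
- by move=> i _; rewrite setTI; exact: measurable_level.
- exact: trivIset_level.
Qed.

Lemma column_sub k : (0 < k)%N -> column a l k `<=` column a l k.+1.
Proof.
move=> k0 x [i /= ih xi].
have [j ja xj] := level_cut_cover a_gt0 l_tower k0 ih xi.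
exists (j * height a k + i)%N => //=; have := cut_height k0 ja ih; lia.
Qed.

Lemma column_sub_add d k : (0 < k)%N -> column a l k `<=` column a l (d + k).
Proof.
move=> k0; elim: d => [//|d IH]; apply: (subset_trans IH).
by rewrite addSn; apply: column_sub; lia.
Qed.

Lemma tower_spaceE : tower_space a l = \bigcup_k column a l k.+1.
Proof.
apply/seteqP; split=> x; first by move=> [[//|k] _ xk]; exists k.
by move=> [k _ xk]; exists k.+1.
Qed.

Lemma measurable_column k : measurable (column a l k).
Proof. by apply: bigcup_measurable => i _; exact: measurable_level. Qed.

Lemma cvg_column_measure :
  (fun k => mu (column a l k.+1)) @ \oo --> mu (tower_space a l).
Proof.
rewrite tower_spaceE; apply: nondecreasing_cvg_mu.
- by move=> k; exact: measurable_column.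
- by apply: bigcup_measurable => k _; exact: measurable_column.
- by apply/nondecreasing_seqP => k; apply/subsetPset; exact: column_sub.
Qed.

(** * The measure of the space *)

Local Notation s k := ((a k * a k.-1)%:R^-1 : R).
Local Notation m k := ((height a k)%:R * w k).

(** The second term is the total length of the q_{k-1} spacers, whose width is
    w_{k+1} = w_{k-1} / (a_k a_{k-1}). *)
Lemma column_measureS k : (1 < k)%N -> m k.+1 = m k + m k.-1 * s k.
Proof.
case: k => [//|[//|k]] _ /=; rewrite [height a k.+3]heightSS // natrD natrM /=.
rewrite (widthS R a_gt0 (isT : (0 < k.+1)%N)).
rewrite (widthS R a_gt0 (isT : (0 < k.+2)%N)).
have a1 : (a k.+1)%:R != 0 :> R by rewrite pnatr_eq0 -lt0n a_gt0.
have a2 : (a k.+2)%:R != 0 :> R by rewrite pnatr_eq0 -lt0n a_gt0.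
rewrite natrM; field; exact/andP.
Qed.

(** C_2 is C_1 cut into pieces: as q_0 = 0, it has no spacer. *)
Lemma column_measure_base : m 1 = 1 /\ m 2 = 1.
Proof.
have m1 : m 1 = 1 by rewrite /width big_geq // mulr1.
split=> //; rewrite -[RHS]m1 heightSS // (widthS R a_gt0 (isT : (0 < 1)%N)) /=.
by rewrite addn0 muln1 mul1r.
Qed.

(** Since m_{k-1} >= 1, the recurrence adds at least 1 / (a_k a_{k-1}). *)
Lemma column_measure_ge n : 1 + \sum_(2 <= i < n.+2) s i <= m n.+2.
Proof.
(* The recurrence has depth two, so the bound 1 <= m_{n+1} is carried along. *)
suff H : 1 <= m n.+1 /\ 1 + \sum_(2 <= i < n.+2) s i <= m n.+2 by case: H.
elim: n => [|n [IH1 IH2]].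
  have [-> ->] := column_measure_base; by rewrite big_geq // addr0.
have s0 k : 0 <= s k by rewrite invr_ge0.
split; first by apply: le_trans IH2; rewrite lerDl sumr_ge0.
rewrite column_measureS // big_nat_recr //= addrA lerD //.
by rewrite ler_peMl // ?ler1n; exact: s0.
Qed.

(** Since m_{k-1} <= m_k, the recurrence multiplies by at most
    1 + 1 / (a_k a_{k-1}), which is at most the exponential of
    1 / (a_k a_{k-1}). *)
Lemma column_measure_le n : m n.+2 <= expR (\sum_(2 <= i < n.+2) s i).
Proof.
suff H : m n.+1 <= m n.+2 /\ m n.+2 <= expR (\sum_(2 <= i < n.+2) s i).
  by case: H.
elim: n => [|n [IH1 IH2]].
  by have [-> ->] := column_measure_base; rewrite big_geq // expR0.
have s0 k : 0 <= s k by rewrite invr_ge0.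
have m0 k : 0 <= m k by rewrite mulr_ge0 // ltW // (width_gt0 R a_gt0).
rewrite (@column_measureS n.+2) //=; split; first by rewrite lerDl mulr_ge0.
rewrite big_nat_recr //= expRD.
apply: (@le_trans _ _ (m n.+2 * (1 + s n.+2))).
  by rewrite mulrDr mulr1 lerD2l ler_wpM2r // s0.
by apply: ler_pM => //; exact: expR_ge1Dx.
Qed.

Lemma tower_space_measure_infinite_iff :
  mu (tower_space a l) = +oo%E <->
  (\sum_(2 <= k <oo) (s k)%:E)%E = +oo%E :> \bar R.
Proof.
have s0 k : (0 <= (s k)%:E)%E by rewrite lee_fin invr_ge0.
split; last first.
  move=> S_infty; apply/eqP; rewrite -leye_eq -S_infty.
  apply: lime_le; first exact: is_cvg_nneseries.
  exists 2%N => // -[|[|n]] // _; rewrite /= sumEFin.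
  apply: (@le_trans _ _ (mu (column a l n.+2))).
    rewrite lebesgue_measure_column // lee_fin.
    by apply: le_trans (column_measure_ge _); rewrite lerDr.
  apply: le_measure; rewrite ?inE.
  - exact: measurable_column.
  - by rewrite tower_spaceE; apply: bigcup_measurable => k _;
      exact: measurable_column.
  - by rewrite tower_spaceE => x xn; exists n.+1.
apply: contraPP => /eqP S_finite X_infty.
set S := (X in X != _) in S_finite.
have S_fin : S \is a fin_num.
  by rewrite ge0_fin_numE ?ltey //; exact: nneseries_ge0.
suff : (mu (tower_space a l) <= (expR (fine S))%:E)%E.
  by rewrite X_infty leye_eq.
rewrite -(cvg_lim _ cvg_column_measure) //.
apply: lime_le; first exact: cvgP cvg_column_measure.
exists 1%N => // -[//|n] _; rewrite /= lebesgue_measure_column // lee_fin.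
apply: le_trans (column_measure_le _) _; rewrite ler_expR -lee_fin fineK //.
by rewrite -sumEFin; exact: nneseries_lim_ge.
Qed.

(** * Preservation of the measure *)

Variable T : R -> R.
Hypothesis T_tower : is_tower_map a l T.
Hypothesis width_cvg0 : forall e : R, 0 < e -> exists k, w k < e.

Local Notation X := (tower_space a l).

Definition nontop k := \bigcup_(i in `I_(height a k).-1) level a l k i.
Definition nonbottom k := \bigcup_(i in `I_(height a k).-1) level a l k i.+1.

Lemma nontop_sub k : (0 < k)%N -> nontop k `<=` nontop k.+1.
Proof.
move=> k0 x [i /= ih xi]; have ih' : (i.+1 < height a k)%N by lia.
have [j ja xj] := level_cut_cover a_gt0 l_tower k0 (ltnW ih') xi.
exists (j * height a k + i)%N => //=; have := cut_height k0 ja ih'; lia.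
Qed.

Lemma nonbottom_sub k : (0 < k)%N -> nonbottom k `<=` nonbottom k.+1.
Proof.
move=> k0 x [i /= ih xi]; have ih' : (i.+1 < height a k)%N by lia.
have [j ja xj] := level_cut_cover a_gt0 l_tower k0 ih' xi.
exists (j * height a k + i)%N; last by rewrite -addnS.
by rewrite /=; have := cut_height k0 ja ih'; lia.
Qed.

(** For k > 1 the column C_{k+1} has q_{k-1} > 0 spacers on top, so none of its
    top levels comes from C_k. *)
Lemma column_sub_nontop k : (1 < k)%N -> column a l k `<=` nontop k.+1.
Proof.
move=> k1 x [i /= ih xi]; have k0 : (0 < k)%N by lia.
have [j ja xj] := level_cut_cover a_gt0 l_tower k0 ih xi.
exists (j * height a k + i)%N => //=; have := cut_height k0 ja ih.
have : (0 < height a k.-1)%N by apply: (height_gt0 a_gt0); lia.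
lia.
Qed.

(** In particular the values of T are determined on the whole space. *)
Lemma tower_space_nontop : X = \bigcup_k nontop k.+1.
Proof.
rewrite tower_spaceE; apply/seteqP; split=> x [k _ xk].
  by exists k.+2 => //; apply: column_sub_nontop => //; exact: column_sub.
by exists k => //; case: xk => i /= ih xi; exists i => //=; lia.
Qed.

Lemma left_endpoint_bottom k : (0 < k)%N -> l k 0%N = 0.
Proof.
elim: k => // -[_ _|k IH _]; first exact: (tower_base l_tower).
have := tower_cut l_tower (isT : 0 < k.+1)%N (a_gt0 (isT : 0 < k.+1)%N)
  (height_gt0 a_gt0 (isT : 0 < k.+1)%N).
by rewrite mul0n addn0 IH // mul0r addr0.
Qed.

Lemma width_antitone d k : (0 < k)%N -> w (d + k) <= w k.
Proof.
move=> k0; elim: d => [//|d]; apply: le_trans.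
have dk0 : (0 < d + k)%N by lia.
rewrite [leRHS](widthS R a_gt0 dk0) addSn ler_peMl ?ler1n ?a_gt0 //.
by rewrite ltW // (width_gt0 R a_gt0).
Qed.

(** A point that stayed in the bottom level of every late column would lie in
    the intervals from 0 to w_k for all large k, whose intersection is empty
    because they are open on the left. *)
Lemma tower_space_nonbottom : X = \bigcup_k nonbottom k.+1.
Proof.
rewrite tower_spaceE; apply/seteqP; split=> x [k _ xk]; last first.
  by exists k => //; case: xk => i /= ih xi; exists i.+1 => //=; lia.
(* A bottom level contains no x <= 0, so no condition on p is needed then. *)
have [p px] : exists p, 0 < x -> w p.+1 < x.
  have [x0|x0] := ltP 0 x; last by exists 0%N.
  have [[|p] px] := width_cvg0 x0; last by exists p.
  by exists 0%N; move: px; rewrite /width !big_geq.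
have := column_sub_add p (isT : 0 < k.+1)%N xk; rewrite addnS => -[i /= ih xi].
exists (p + k)%N => //; case: i => [|i] in ih xi; last by exists i => //=; lia.
move: xi; rewrite /level /= in_itv /= left_endpoint_bottom // add0r.
have := @width_antitone k p.+1 isT; rewrite addnS (addnC k) => W.
by move=> /andP[/px x1 x2]; move: (lt_le_trans x1 x2); rewrite ltNge W.
Qed.

(** On a non-top level T is a translation, and it maps the level exactly onto
    the next one; this turns preimages under T into translates. *)
Lemma level_preimage k i A : (0 < k)%N -> (i < (height a k).-1)%N ->
  T @^-1` A `&` level a l k i =
  (fun x => x + (l k i.+1 - l k i)) @^-1` (A `&` level a l k i.+1).
Proof.
move=> k0 ih; have E x : level a l k i x -> T x = x + (l k i.+1 - l k i).
  by apply: T_tower => //; lia.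
have L x : level a l k i x <-> level a l k i.+1 (x + (l k i.+1 - l k i)).
  rewrite /level /= !in_itv /=; split=> /andP[x1 x2]; apply/andP; split; lra.
apply/seteqP; split=> x /=.
  by move=> [Ax xi]; rewrite -E //; split=> //; rewrite E //; apply/L.
by move=> [Ax /L xi]; rewrite E.
Qed.

Lemma measurable_level_preimage k i A : (0 < k)%N ->
  (i < (height a k).-1)%N -> measurable A ->
  measurable (T @^-1` A `&` level a l k i).
Proof.
move=> k0 ih mA; rewrite level_preimage // -[X in measurable X]setTI.
have mc : measurable_fun [set: R] (fun x : R => x + (l k i.+1 - l k i)).
  exact: measurable_funD.
by apply: mc => //; apply: measurableI => //; exact: measurable_level.
Qed.

(** The levels being disjoint, the two sides agree level by level, by
    translation invariance. *)
Lemma measure_preimage_nontop k A : (0 < k)%N -> measurable A ->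
  mu (T @^-1` A `&` nontop k) = mu (A `&` nonbottom k).
Proof.
move=> k0 mA; rewrite !measure_tiling.
- apply: eq_bigr => -[i /= ih] _; rewrite level_preimage //.
  apply: lebesgue_measure_translate; apply: measurableI => //.
  exact: measurable_level.
- by move=> i ih; apply: measurableI => //; exact: measurable_level.
- move=> i j /= ih jh [x [xi xj]]; apply: succn_inj.
  by apply: (level_inj a_gt0 l_tower k0 _ _ xi xj); lia.
- by move=> i ih; exact: measurable_level_preimage.
- move=> i j /= ih jh [x [xi xj]].
  by apply: (level_inj a_gt0 l_tower k0 _ _ xi xj); lia.
Qed.

Lemma measurable_preimage_nontop k A : (0 < k)%N -> measurable A ->
  measurable (T @^-1` A `&` nontop k).
Proof.
move=> k0 mA; rewrite setI_bigcupr; apply: bigcup_measurable => i ih.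
exact: measurable_level_preimage.
Qed.

(** Both sides of measure_preimage_nontop increase with k, to the measure of the
    preimage of A and to that of A. *)
Lemma tower_map_measure_preserving : measure_preserving_on X T.
Proof.
have mX : measurable X.
  by rewrite tower_spaceE; apply: bigcup_measurable => k _;
    exact: measurable_column.
have mT A : measurable A -> measurable (T @^-1` A `&` X).
  move=> mA; rewrite tower_space_nontop setI_bigcupr.
  by apply: bigcup_measurable => k _; exact: measurable_preimage_nontop.
split=> //.
- move=> x; rewrite {1}tower_space_nontop tower_spaceE => -[k _ [i /= ih xi]].
  exists k => //; exists i.+1 => /=; first by lia.
  have : (T @^-1` [set T x] `&` level a l k.+1 i) x by split.
  by rewrite level_preimage // => -[/= <-].
- by move=> _ A mA; rewrite setIC; exact: mT.
move=> A mA AX; rewrite setIC -[in RHS]((setIidPl _ _).2 AX).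
have cvg_top : mu (T @^-1` A `&` nontop k.+1) @[k --> \oo] -->
    mu (T @^-1` A `&` X).
  have E : T @^-1` A `&` X = \bigcup_k (T @^-1` A `&` nontop k.+1).
    by rewrite tower_space_nontop setI_bigcupr.
  rewrite E; apply: nondecreasing_cvg_mu.
  - by move=> k; exact: measurable_preimage_nontop.
  - by rewrite -E; exact: mT.
  - apply/nondecreasing_seqP => k; apply/subsetPset; apply: setIS.
    exact: nontop_sub.
have cvg_bottom : mu (A `&` nonbottom k.+1) @[k --> \oo] --> mu (A `&` X).
  have E : A `&` X = \bigcup_k (A `&` nonbottom k.+1).
    by rewrite tower_space_nonbottom setI_bigcupr.
  have mb k : measurable (nonbottom k).
    by apply: bigcup_measurable => i _; exact: measurable_level.
  rewrite E; apply: nondecreasing_cvg_mu.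
  - move=> k; apply: measurableI; [exact: mA | exact: mb].
  - by rewrite -E; apply: measurableI; [exact: mA | exact: mX].
  - apply/nondecreasing_seqP => k; apply/subsetPset; apply: setIS.
    exact: nonbottom_sub.
have E : (fun k => mu (A `&` nonbottom k.+1)) =
    (fun k => mu (T @^-1` A `&` nontop k.+1)).
  by apply/funext => k; apply/esym/measure_preimage_nontop.
rewrite E in cvg_bottom; exact: cvg_unique cvg_top cvg_bottom.
Qed.

End Towers.

(** * Widths tend to zero outside golden type *)

(** Widths decrease, and a factor a_k >= 2 halves them. *)
Lemma width_small (R : realType) (a : nat -> nat) :
  (forall k, (0 < k)%N -> (0 < a k)%N) ->
  (forall n, exists2 k, (n <= k)%N & (1 < a k)%N) ->
  forall e : R, 0 < e -> exists k, width R a k < e.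
Proof.
move=> a_gt0 a_big e e0.
have half p : exists2 k, (0 < k)%N & width R a k <= 2^-1 ^+ p.
  elim: p => [|p [k k0 IH]]; first by exists 1%N; rewrite // /width big_geq.
  have [j kj aj] := a_big k; have j0 : (0 < j)%N by lia.
  exists j.+1 => //; have := widthS R a_gt0 j0 => Wj.
  have := @width_antitone R a a_gt0 (j - k) k k0; rewrite subnK // => W.
  have : 2 * width R a j.+1 <= width R a j.
    by rewrite Wj ler_wpM2r ?ler_nat // ltW // (width_gt0 R a_gt0).
  rewrite exprS; lra.
have [p pe] : exists p, (2^-1 : R) ^+ p < e.
  exists (Num.bound e^-1).
  rewrite exprVn invf_plt ?posrE ?exprn_gt0 //.
  exact: upper_nthrootP.
have [k _ Wk] := half p; exists k; exact: le_lt_trans Wk pe.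
Qed.

(** As pq is an absolute value, pq = 1 forces a partial quotient equal to 1 only
    once its sign is known; it is nonnegative from index 1 on. *)
Lemma not_golden_pq_gt1 (R : realType) (alpha : R) :
  irrational alpha -> ~ golden_type alpha ->
  forall n, exists2 k, (n <= k)%N & (1 < pq alpha k)%N.
Proof.
move=> irr not_golden n; apply: contrapT => no; apply: not_golden.
exists n.+1 => -[//|k] nk; have k0 := pq_gt0 irr (isT : (0 < k.+1)%N).
have pq1 : pq alpha k.+1 = 1%N.
  apply/eqP; rewrite eqn_leq k0 andbT leqNgt; apply/negP => k1.
  by apply: no; exists k.+1 => //; lia.
have : 0 <= partial_quotient alpha k.+1.
  by rewrite /partial_quotient floor_ge0 /= invr_ge0 subr_ge0 floor_le.
by move: pq1; rewrite /pq; lia.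
Qed.

Theorem theorem5p1 (R : realType) (alpha : R)
    (alpha_irrational : irrational alpha)
    (alpha_not_golden : ~ golden_type alpha)
    (l : nat -> nat -> R) (l_tower : is_tower (pq alpha) l)
    (T : R -> R) (T_tower : is_tower_map (pq alpha) l T) :
  measure_preserving_on (tower_space (pq alpha) l) T /\
  (lebesgue_measure (tower_space (pq alpha) l) = +oo%E <->
   (\sum_(2 <= k <oo) ((pq alpha k * pq alpha k.-1)%:R^-1)%:E)%E
     = +oo%E :> \bar R).
Proof.
have pq_pos k : (0 < k)%N -> (0 < pq alpha k)%N by exact: pq_gt0.
split; last exact: tower_space_measure_infinite_iff.
apply: tower_map_measure_preserving => //.
by apply: width_small => //; exact: not_golden_pq_gt1.
Qed.
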